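(* It is impossible to express in FTCpm (fracterm calculus for partial meadows), thus by formulae in $\mathsf{L_{sfol}}(\Sigma^{pd}_m)$, that division is not total.
   Context: Signature and structures. $\Sigma^{pd}_m$ is the one-sorted signature of unital rings (constants $0,1$; total functions $+,\cdot$ binary, $-$ unary) extended with a binary division symbol $\frac{x}{y}$ marked as partial. A partial meadow $F^{pd}$ is a $\Sigma^{pd}_m$-structure obtained by expanding a field $F$ with the usual partial division operator: $\frac ab=c$ if $b\neq0$ and $b\cdot c=a$, with $\frac a0$ undefined. $\mathsf{Tot}_0(F^{pd})$ denotes the structure obtained from $F^{pd}$ by making division total through $\frac x0=0$. Formulae. $\mathsf{L_{sfol}}(\Sigma^{pd}_m)$ is built from $\mathsf T,\mathsf F$ and atoms $t=_{\mathsf p}r$ ($t,r$ terms, possibly with variables) using $\neg$, the short-circuit connectives $\vee_\ell,\wedge_\ell,\to_\ell$, and quantifiers $\forall_{\mathsf p},\exists_{\mathsf p}$, where $\phi\wedge_\ell\psi$ means $\neg(\neg\phi\vee_\ell\neg\psi)$, $\phi\to_\ell\psi$ means $\neg\phi\vee_\ell\psi$, and $\exists_{\mathsf p}x.\phi$ means $\neg\forall_{\mathsf p}x.\neg\phi$. FTCpm is the collection of quantifier-free formulae of $\mathsf{L_{sfol}}(\Sigma^{pd}_m)$ that are valid in all partial meadows. Semantics. Let $A$ be a $\Sigma^{pd}_m$-structure with non-empty domain $|A|$, in which division may be partial. A valuation $\sigma$ assigns elements of $|A|$ to variables; it extends to terms strictly ($\sigma(f(t_1,\dots,t_k))$ is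 defined iff all $\sigma(t_i)$ are defined and $f$ is defined on them). $\sigma[a/x]$ is $\sigma$ modified to send $x$ to $a$. Satisfaction $A,\sigma\models\phi$ and denial satisfaction $A,\sigma\models^-\phi$ are defined inductively by: - $A,\sigma\models\mathsf T$; $A,\sigma\models^-\mathsf F$ (and $\mathsf T$ is never denied, $\mathsf F$ never satisfied); - $A,\sigma\models t=_{\mathsf p}r$ iff $\sigma(t),\sigma(r)$ are both defined and equal; $A,\sigma\models^- t=_{\mathsf p}r$ iff both are defined and different; - $A,\sigma\models\neg\phi$ iff $A,\sigma\models^-\phi$; $A,\sigma\models^-\neg\phi$ iff $A,\sigma\models\phi$; - $A,\sigma\models\phi_1\vee_\ell\phi_2$ iff $A,\sigma\models\phi_1$, or both $A,\sigma\models^-\phi_1$ and $A,\sigma\models\phi_2$; $A,\sigma\models^-\phi_1\vee_\ell\phi_2$ iff $A,\sigma\models^-\phi_1$ and $A,\sigma\models^-\phi_2$; - $A,\sigma\models\forall_{\mathsf p}x.\phi$ iff $A,\sigma[a/x]\models\phi$ for all $a\in|A|$; $A,\sigma\models^-\forall_{\mathsf p}x.\phi$ iff $A,\sigma[a/x]\models^-\phi$ for some $a\in|A|$ and $A,\sigma[b/x]\models\phi\vee_\ell\neg\phi$ for all $b\in|A|$. $A\models\phi$ means $A,\sigma\models\phi$ for all valuations $\sigma$. Sense of ''impossible to express''. The sense established by the source's argument is: for every partial meadow $F^{pd}$, no formula $\phi\in\mathsf{L_{sfol}}(\Sigma^{pd}_m)$ can distinguish between $F^{pd}$ and $\mathsf{Tot}_0(F^{pd})$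 by being true for $F^{pd}$ and not for $\mathsf{Tot}_0(F^{pd})$; that is, $F^{pd}\models\phi$ implies $\mathsf{Tot}_0(F^{pd})\models\phi$. *)

(* Defs.v *)
(* MathComp *)
From HB Require Import structures.
From mathcomp Require Import all_boot all_algebra.

Set Implicit Arguments.
Unset Strict Implicit.
Unset Printing Implicit Defensive.

Import GRing.Theory.
Local Open Scope ring_scope.

Inductive term : Type :=
| TVar of nat
| TZero
| TOne
| TAdd of term & term
| TMul of term & term
| TOpp of term
| TDiv of term & term.

(* The disjunction is the short-circuit one, evaluated from left to right. *)
Inductive formula : Type :=
| FTrue
| FFalse
| FEq of term & term
| FNeg of formula
| FOr of formula & formula
| FAll of nat & formula.

Definition FAnd (phi psi : formula) : formula := FNeg (FOr (FNeg phi) (FNeg psi)).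
Definition FImp (phi psi : formula) : formula := FOr (FNeg phi) psi.
Definition FEx (x : nat) (phi : formula) : formula := FNeg (FAll x (FNeg phi)).

(* Division is the only partial operation; [None] means undefined.
   The domain is non-empty because it contains [szero]. *)
Record structure : Type := Structure {
  carrier :> Type;
  szero : carrier;
  sone : carrier;
  sadd : carrier -> carrier -> carrier;
  smul : carrier -> carrier -> carrier;
  sopp : carrier -> carrier;
  sdiv : carrier -> carrier -> option carrier
}.

Fixpoint eval (A : structure) (s : nat -> A) (t : term) : option A :=
  match t with
  | TVar x => Some (s x)
  | TZero => Some (szero A)
  | TOne => Some (sone A)
  | TAdd t1 t2 =>
      if eval s t1 is Some a then
        if eval s t2 is Some b then Some (sadd a b) else None
      else None
  | TMul t1 t2 =>
      if eval s t1 is Some a then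
        if eval s t2 is Some b then Some (smul a b) else None
      else None
  | TOpp t1 => if eval s t1 is Some a then Some (sopp a) else None
  | TDiv t1 t2 =>
      if eval s t1 is Some a then
        if eval s t2 is Some b then sdiv a b else None
      else None
  end.

Definition upd (A : structure) (s : nat -> A) (x : nat) (a : A) : nat -> A :=
  [eta s with x |-> a].

(* [sat] is satisfaction and [dsat] denial satisfaction.  Denying a universal
   formula requires, besides a counterexample, that the body is either
   satisfied or denied at every element. *)
Inductive sat (A : structure) : (nat -> A) -> formula -> Prop :=
| sat_true s : sat s FTrue
| sat_eq s t r a :
    eval s t = Some a -> eval s r = Some a -> sat s (FEq t r)
| sat_neg s phi : dsat s phi -> sat s (FNeg phi)
| sat_orl s phi psi : sat s phi -> sat s (FOr phi psi)
| sat_orr s phi psi : dsat s phi -> sat s psi -> sat s (FOr phi psi)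
| sat_all s x phi :
    (forall a : A, sat (upd s x a) phi) -> sat s (FAll x phi)
with dsat (A : structure) : (nat -> A) -> formula -> Prop :=
| dsat_false s : dsat s FFalse
| dsat_eq s t r a b :
    eval s t = Some a -> eval s r = Some b -> a <> b -> dsat s (FEq t r)
| dsat_neg s phi : sat s phi -> dsat s (FNeg phi)
| dsat_or s phi psi : dsat s phi -> dsat s psi -> dsat s (FOr phi psi)
| dsat_all s x phi (a : A) :
    dsat (upd s x a) phi ->
    (forall b : A, sat (upd s x b) (FOr phi (FNeg phi))) ->
    dsat s (FAll x phi).

Definition models (A : structure) (phi : formula) : Prop :=
  forall s : nat -> A, sat s phi.

Definition pdiv (F : fieldType) (a b : F) : option F :=
  if b == 0 then None else Some (a / b).

Lemma pdivP (F : fieldType) (a b c : F) :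
  pdiv a b = Some c <-> b <> 0 /\ b * c = a.
Proof.
rewrite /pdiv; case: eqP => [->|/eqP b0]; split=> //; first by case.
  by case=> <-; split; [exact/eqP | rewrite mulrC divfK].
by case=> _ <-; rewrite (mulrC b) mulfK.
Qed.

Definition partial_meadow (F : fieldType) : structure :=
  @Structure F 0 1 +%R *%R -%R (@pdiv F).

(* In a partial meadow the quotients made equal to 0 are exactly those with
   denominator 0. *)
Definition Tot0 (A : structure) : structure :=
  @Structure A (szero A) (sone A) (@sadd A) (@smul A) (@sopp A)
    (fun a b => Some (odflt (szero A) (sdiv a b))).

(* Main.v *)
(* Totalizing division only turns undefined terms into defined ones. Both
   satisfaction and denial of an equation require its two sides to be defined,
   and every other semantic clause is positive in satisfaction and denial, so
   both relations persist from a structure to its totalization. *)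
Require Import Defs.
From HB Require Import structures.
From mathcomp Require Import all_boot all_algebra.

Scheme sat_dsat_ind := Minimality for sat Sort Prop
  with dsat_sat_ind := Minimality for dsat Sort Prop.
Combined Scheme sat_dsat_mutind from sat_dsat_ind, dsat_sat_ind.

Lemma eval_Tot0 (A : structure) (s : nat -> A) (t : term) (a : A) :
  eval s t = Some a -> eval (A := Tot0 A) s t = Some a.
Proof.
elim: t a => [x|||t IHt r IHr|t IHt r IHr|t IHt|t IHt r IHr] a //=.
- case: (eval s t) IHt => [b|//] /(_ _ erefl) ->.
  by case: (eval s r) IHr => [c|//] /(_ _ erefl) ->.
- case: (eval s t) IHt => [b|//] /(_ _ erefl) ->.
  by case: (eval s r) IHr => [c|//] /(_ _ erefl) ->.
- by case: (eval s t) IHt => [b|//] /(_ _ erefl) ->.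
- case: (eval s t) IHt => [b|//] /(_ _ erefl) ->.
  (* The last rewrite uses that the quotient is defined in [A], so [odflt] returns it and never its
     default. *)
  by case: (eval s r) IHr => [c|//] /(_ _ erefl) -> ->.
Qed.

(** Negation swaps the two relations, so neither half goes through alone; both follow by mutual
    induction on derivations. *)
Lemma sat_dsat_Tot0 (A : structure) :
  (forall (s : nat -> A) phi, sat s phi -> sat (A := Tot0 A) s phi) /\
  (forall (s : nat -> A) phi, dsat s phi -> dsat (A := Tot0 A) s phi).
Proof.
apply: sat_dsat_mutind.
- by move=> s; apply: sat_true.
- by move=> s t r a /eval_Tot0 ta /eval_Tot0 ra; apply: sat_eq ta ra.
- by move=> s phi _ dphi; apply: sat_neg.
- by move=> s phi psi _ sphi; apply: sat_orl.
- by move=> s phi psi _ dphi _ spsi; apply: sat_orr.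
- by move=> s x phi _ sphi; apply: sat_all.
- by move=> s; apply: dsat_false.
- by move=> s t r a b /eval_Tot0 ta /eval_Tot0 rb; apply: dsat_eq ta rb.
- by move=> s phi _ sphi; apply: dsat_neg.
- by move=> s phi psi _ dphi _ dpsi; apply: dsat_or.
(* The domain is unchanged, so [a] is still a counterexample; definedness of the body is itself a
   satisfaction claim, hence covered by induction. *)
- by move=> s x phi a _ dphi _ phi_def; apply: dsat_all dphi phi_def.
Qed.

Theorem proposition3p3p5 (F : fieldType) (phi : formula) :
  models (partial_meadow F) phi -> models (Tot0 (partial_meadow F)) phi.
Proof. by move=> Fphi s; apply: (sat_dsat_Tot0 _).1 (Fphi s). Qed.
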